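(* The category $\mathsf{LPM}$ of left pseudocancellative unital magmas is a unital category, and there exists a weakly protomodular object in $\mathsf{LPM}$ which has a subobject that is not weakly protomodular in $\mathsf{LPM}$ and which is not a protomodular object in $\mathsf{LPM}$. In particular, the notions of protomodular object and weakly protomodular object do not coincide in all unital categories.
   Context: A left pseudocancellative unital magma (LPM) is a set $X$ with two binary operations $*$ and $\backslash$ and a nullary operation (constant) $e\in X$ satisfying, for all $x,y\in X$, the identities $y = x*(x\backslash y)$ and $x = e*x = x*e$. The category $\mathsf{LPM}$ has LPMs as objects and maps preserving $*$, $\backslash$ and $e$ as morphisms; it is a pointed variety of universal algebras (the zero object is the one-element algebra). Let $\mathcal{C}$ be a pointed finitely complete category. Two morphisms $f\colon A\to C$ and $g\colon B\to C$ are jointly extremal-epimorphic if, whenever both factor through a common monomorphism $m\colon M\to C$, then $m$ is an isomorphism. The category $\mathcal{C}$ is unital if for all objects $X,Y$ the morphisms $\langle 1_X,0\rangle\colon X\to X\times Y$ and $\langle 0,1_Y\rangle\colon Y\to X\times Y$ are jointly extremal-epimorphic. A point over $X$ is a pair $(f\colon A\to X,\ s\colon X\to A)$ with $f\circ s=1_X$. It is strong if $s$ and the kernel $k\colon K\to A$ of $f$ are jointly extremal-epimorphic. It is stably strong if for every morphism $g\colon Z\to X$ the pulled-back point $(\pi_Z\colon Z\times_X A\to Z,\ \langle 1_Z, s\circ g\rangle\colon Z\to Z\times_X A)$ is strong. An object $X$ is weakly protomodular (in $\mathcal{C}$) if every point over $X$ is strong, and protomodular (in $\mathcal{C}$) if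 every point over $X$ is stably strong. *)

(* Defs.v *)
From Stdlib Require Import List FinFun FunctionalExtensionality ProofIrrelevance.

Declare Scope cat_scope.
Delimit Scope cat_scope with cat.

Record category : Type := Category {
  ob :> Type;
  hom : ob -> ob -> Type;
  idm : forall A, hom A A;
  comp : forall A B C, hom B C -> hom A B -> hom A C;
  comp_idl : forall A B (f : hom A B), comp A B B (idm B) f = f;
  comp_idr : forall A B (f : hom A B), comp A A B f (idm A) = f;
  comp_assoc : forall A B C D (h : hom C D) (g : hom B C) (f : hom A B),
    comp A B D (comp B C D h g) f = comp A C D h (comp A B C g f)
}.

Arguments hom {c} A B.
Arguments idm {c} A.
Arguments comp {c A B C} g f.

Notation "g ∘ f" := (comp g f) (at level 40, left associativity) : cat_scope.
Open Scope cat_scope.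

Definition is_mono {C : category} {A B : C} (m : hom A B) : Prop :=
  forall (T : C) (u v : hom T A), m ∘ u = m ∘ v -> u = v.

Definition is_iso {C : category} {A B : C} (m : hom A B) : Prop :=
  exists n : hom B A, n ∘ m = idm A /\ m ∘ n = idm B.

Record functor (J C : category) : Type := Functor {
  fob :> J -> C;
  fmap : forall i j : J, hom i j -> hom (fob i) (fob j);
  fmap_id : forall i : J, fmap i i (idm i) = idm (fob i);
  fmap_comp : forall (i j k : J) (b : hom j k) (a : hom i j),
    fmap i k (b ∘ a) = fmap j k b ∘ fmap i j a
}.

Arguments fob {J C} f i.
Arguments fmap {J C} f {i j} a.

Definition is_cone {J C : category} (F : functor J C) (L : C)
    (p : forall i : J, hom L (F i)) : Prop :=
  forall (i j : J) (a : hom i j), fmap F a ∘ p i = p j.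

Definition is_limit {J C : category} (F : functor J C) (L : C)
    (p : forall i : J, hom L (F i)) : Prop :=
  is_cone F L p /\
  forall (T : C) (q : forall i : J, hom T (F i)), is_cone F T q ->
    exists! u : hom T L, forall i : J, p i ∘ u = q i.

Definition finite_category (J : category) : Prop :=
  Finite J /\ forall i j : J, Finite (hom i j).

Definition finitely_complete (C : category) : Prop :=
  forall (J : category) (F : functor J C), finite_category J ->
    exists (L : C) (p : forall i : J, hom L (F i)), is_limit F L p.

Definition is_zero_object {C : category} (Z : C) : Prop :=
  (forall A : C, exists! f : hom A Z, True) /\
  (forall A : C, exists! f : hom Z A, True).

Definition pointed (C : category) : Prop := exists Z : C, is_zero_object Z.

Definition is_zero_morphism {C : category} {A B : C} (f : hom A B) : Prop :=
  exists (Z : C) (u : hom A Z) (v : hom Z B), is_zero_object Z /\ f = v ∘ u.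

Definition is_product {C : category} {X Y P : C}
    (p : hom P X) (q : hom P Y) : Prop :=
  forall (T : C) (a : hom T X) (b : hom T Y),
    exists! u : hom T P, p ∘ u = a /\ q ∘ u = b.

Definition is_pullback {C : category} {Z X A P : C}
    (g : hom Z X) (f : hom A X) (p : hom P Z) (q : hom P A) : Prop :=
  g ∘ p = f ∘ q /\
  forall (T : C) (a : hom T Z) (b : hom T A), g ∘ a = f ∘ b ->
    exists! u : hom T P, p ∘ u = a /\ q ∘ u = b.

Definition is_kernel {C : category} {K A X : C}
    (k : hom K A) (f : hom A X) : Prop :=
  is_zero_morphism (f ∘ k) /\
  forall (T : C) (t : hom T A), is_zero_morphism (f ∘ t) ->
    exists! u : hom T K, k ∘ u = t.

Definition jointly_extremal_epi {C : category} {A B D : C}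
    (f : hom A D) (g : hom B D) : Prop :=
  forall (M : C) (m : hom M D), is_mono m ->
    (exists f' : hom A M, f = m ∘ f') ->
    (exists g' : hom B M, g = m ∘ g') ->
    is_iso m.

(* Products, kernels and pullbacks are not chosen: being determined up to
   isomorphism, they are quantified over universally below.  In [unital], [l]
   and [r] are the morphisms <1,0> and <0,1> into the product. *)

Definition unital (C : category) : Prop :=
  pointed C /\ finitely_complete C /\
  forall (X Y P : C) (p : hom P X) (q : hom P Y), is_product p q ->
  forall (l : hom X P) (r : hom Y P),
    p ∘ l = idm X -> is_zero_morphism (q ∘ l) ->
    is_zero_morphism (p ∘ r) -> q ∘ r = idm Y ->
    jointly_extremal_epi l r.

Definition is_point {C : category} {A X : C}
    (f : hom A X) (s : hom X A) : Prop := f ∘ s = idm X.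

Definition strong_point {C : category} {A X : C}
    (f : hom A X) (s : hom X A) : Prop :=
  is_point f s /\
  forall (K : C) (k : hom K A), is_kernel k f -> jointly_extremal_epi s k.

(* [t] is the induced section <1_Z, s g> of the pulled-back point. *)
Definition stably_strong_point {C : category} {A X : C}
    (f : hom A X) (s : hom X A) : Prop :=
  is_point f s /\
  forall (Z : C) (g : hom Z X) (P : C) (p : hom P Z) (q : hom P A),
    is_pullback g f p q ->
    forall t : hom Z P, p ∘ t = idm Z -> q ∘ t = s ∘ g ->
      strong_point p t.

Definition weakly_protomodular {C : category} (X : C) : Prop :=
  forall (A : C) (f : hom A X) (s : hom X A),
    is_point f s -> strong_point f s.

Definition protomodular {C : category} (X : C) : Prop :=
  forall (A : C) (f : hom A X) (s : hom X A),
    is_point f s -> stably_strong_point f s.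

(* [ldiv x y] is x \ y. *)
Record lpm : Type := Lpm {
  carrier :> Type;
  mul : carrier -> carrier -> carrier;
  ldiv : carrier -> carrier -> carrier;
  unit_el : carrier;
  mul_ldiv : forall x y, y = mul x (ldiv x y);
  mul_1l : forall x, x = mul unit_el x;
  mul_1r : forall x, x = mul x unit_el
}.

Arguments mul {l} x y.
Arguments ldiv {l} x y.
Arguments unit_el {l}.

Record lpm_hom (A B : lpm) : Type := LpmHom {
  lpm_fun :> A -> B;
  lpm_fun_mul : forall x y, lpm_fun (mul x y) = mul (lpm_fun x) (lpm_fun y);
  lpm_fun_ldiv : forall x y, lpm_fun (ldiv x y) = ldiv (lpm_fun x) (lpm_fun y);
  lpm_fun_unit : lpm_fun unit_el = unit_el
}.

Arguments LpmHom {A B} lpm_fun _ _ _.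
Arguments lpm_fun {A B} l x.
Arguments lpm_fun_mul {A B} l x y.
Arguments lpm_fun_ldiv {A B} l x y.
Arguments lpm_fun_unit {A B} l.

Lemma lpm_hom_ext (A B : lpm) (f g : lpm_hom A B) :
  (forall x, f x = g x) -> f = g.
Proof.
  destruct f as [f f1 f2 f3], g as [g g1 g2 g3]; cbn; intro H.
  assert (E : f = g) by (apply functional_extensionality; exact H).
  subst g; f_equal; apply proof_irrelevance.
Qed.

Definition lpm_id (A : lpm) : lpm_hom A A :=
  LpmHom (fun x => x) (fun _ _ => eq_refl) (fun _ _ => eq_refl) eq_refl.

Definition lpm_comp (A B C : lpm) (g : lpm_hom B C) (f : lpm_hom A B) :
  lpm_hom A C.
Proof.
  refine (LpmHom (fun x => g (f x)) _ _ _).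
  - intros x y; rewrite lpm_fun_mul; apply lpm_fun_mul.
  - intros x y; rewrite lpm_fun_ldiv; apply lpm_fun_ldiv.
  - rewrite lpm_fun_unit; apply lpm_fun_unit.
Defined.

Definition LPM : category.
Proof.
  refine (Category lpm lpm_hom lpm_id lpm_comp _ _ _);
    intros; apply lpm_hom_ext; reflexivity.
Defined.

(* Main.v *)
Require Import Defs.
From Stdlib Require Import List FinFun FunctionalExtensionality ProofIrrelevance.
From Stdlib Require Import IndefiniteDescription ZArith Lia.

(** If [x \ x = e] in the base [X] of a point [(f, s)], then any [a] over [x]
    equals [s x * (s x \ a)] with [s x \ a] in the kernel of [f].  More
    generally [a = s y * (s y \ a)] for any [y], so [a] is generated by [s X]
    and the kernel as soon as the elements over [y \ x] are.  The object [base]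
    has carrier [Z]: its elements [x <= 1] satisfy [x \ x = 0], and
    [1 \ x = x - 1] reaches the other ones inductively.  The subobject
    [{0, 2, 3, ...}] omits [1], and there [x \ y] is never the unit when
    [x <> 0].  One point over [base], with total object [Z * Z], restricts to
    a point over this subobject which is not strong. *)

(** * Subalgebras, products and the trivial algebra *)

Record subalgebra {A : lpm} (P : A -> Prop) : Prop := Subalgebra {
  subalgebra_unit : P unit_el;
  subalgebra_mul : forall x y, P x -> P y -> P (mul x y);
  subalgebra_ldiv : forall x y, P x -> P y -> P (ldiv x y)
}.

Arguments subalgebra_unit {A P}.
Arguments subalgebra_mul {A P}.
Arguments subalgebra_ldiv {A P}.

Lemma sig_ext {T : Type} (P : T -> Prop) (x y : {t : T | P t}) :
  proj1_sig x = proj1_sig y -> x = y.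
Proof.
  destruct x as [x hx], y as [y hy]; cbn; intro E; subst y.
  f_equal; apply proof_irrelevance.
Qed.

Definition sub_lpm {A : lpm} (P : A -> Prop) (H : subalgebra P) : lpm.
Proof.
  refine (Lpm {x : A | P x}
    (fun x y => exist _ (mul (proj1_sig x) (proj1_sig y))
       (subalgebra_mul H _ _ (proj2_sig x) (proj2_sig y)))
    (fun x y => exist _ (ldiv (proj1_sig x) (proj1_sig y))
       (subalgebra_ldiv H _ _ (proj2_sig x) (proj2_sig y)))
    (exist _ unit_el (subalgebra_unit H)) _ _ _);
    intros; apply sig_ext; cbn.
  - apply mul_ldiv.
  - apply mul_1l.
  - apply mul_1r.
Defined.

Definition sub_incl {A : lpm} (P : A -> Prop) (H : subalgebra P) :
  lpm_hom (sub_lpm P H) A :=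
  @LpmHom (sub_lpm P H) A (fun x => proj1_sig x)
    (fun _ _ => eq_refl) (fun _ _ => eq_refl) eq_refl.

Definition sub_corestr {T A : lpm} (P : A -> Prop) (H : subalgebra P)
  (h : lpm_hom T A) (hP : forall t, P (h t)) : lpm_hom T (sub_lpm P H).
Proof.
  refine (@LpmHom T (sub_lpm P H) (fun t => exist _ (h t) (hP t)) _ _ _);
    intros; apply sig_ext; cbn.
  - apply lpm_fun_mul.
  - apply lpm_fun_ldiv.
  - apply lpm_fun_unit.
Defined.

Definition prod_lpm {I : Set} (D : I -> lpm) : lpm.
Proof.
  refine (Lpm (forall i, D i) (fun x y i => mul (x i) (y i))
    (fun x y i => ldiv (x i) (y i)) (fun i => unit_el) _ _ _);
    intros; apply functional_extensionality_dep; intro i.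
  - apply mul_ldiv.
  - apply mul_1l.
  - apply mul_1r.
Defined.

Definition prod_proj {I : Set} (D : I -> lpm) (i : I) :
  lpm_hom (prod_lpm D) (D i) :=
  @LpmHom (prod_lpm D) (D i) (fun x => x i)
    (fun _ _ => eq_refl) (fun _ _ => eq_refl) eq_refl.

Definition prod_tuple {I : Set} (D : I -> lpm) (T : lpm)
  (h : forall i, lpm_hom T (D i)) : lpm_hom T (prod_lpm D).
Proof.
  refine (@LpmHom T (prod_lpm D) (fun t i => h i t) _ _ _);
    intros; apply functional_extensionality_dep; intro i.
  - apply lpm_fun_mul.
  - apply lpm_fun_ldiv.
  - apply lpm_fun_unit.
Defined.

Definition one_lpm : lpm.
Proof.
  refine (Lpm unit (fun _ _ => tt) (fun _ _ => tt) tt _ _ _);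
    repeat intros []; reflexivity.
Defined.

Definition const_hom (A B : lpm) : lpm_hom A B.
Proof.
  refine (@LpmHom A B (fun _ => unit_el) _ _ _).
  - intros; apply mul_1l.
  (* Here [e \ e = e * (e \ e) = e]. *)
  - intros; rewrite (mul_1l _ (ldiv _ _)); apply mul_ldiv.
  - reflexivity.
Defined.

Lemma hom_eq_app {A B : lpm} {f g : lpm_hom A B} :
  f = g -> forall x, f x = g x.
Proof. now intros ->. Qed.

(** * Zero object and zero morphisms *)

Lemma one_lpm_zero : is_zero_object (C := LPM) one_lpm.
Proof.
  split; intro A.
  - exists (const_hom A one_lpm); split; [exact I |].
    intros g _; apply lpm_hom_ext; intro x; now destruct (lpm_fun g x).
  - exists (const_hom one_lpm A); split; [exact I |].
    intros g _; apply lpm_hom_ext; intros []; symmetry.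
    exact (lpm_fun_unit g).
Qed.

Lemma zero_morphism_iff {A B : lpm} (f : lpm_hom A B) :
  is_zero_morphism (C := LPM) f <-> forall x, f x = unit_el.
Proof.
  split.
  - intros (Z & u & v & [_ HZ] & ->) x; cbn.
    destruct (HZ Z) as [w [_ Hw]].
    (* A zero object has one endomorphism, so all its elements are the unit. *)
    assert (E : lpm_id Z = const_hom Z Z).
    { transitivity w; [symmetry |]; now apply Hw. }
    generalize (hom_eq_app E (lpm_fun u x)); cbn; intros ->.
    apply lpm_fun_unit.
  - intro H; exists one_lpm, (const_hom A one_lpm), (const_hom one_lpm B).
    split; [apply one_lpm_zero |].
    apply lpm_hom_ext; exact H.
Qed.

Lemma equalizer_subalgebra {A B : lpm} (f g : lpm_hom A B) :
  subalgebra (fun x => f x = g x).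
Proof.
  split.
  - now rewrite !lpm_fun_unit.
  - intros x y Hx Hy; now rewrite !lpm_fun_mul, Hx, Hy.
  - intros x y Hx Hy; now rewrite !lpm_fun_ldiv, Hx, Hy.
Qed.

Lemma subalgebra_and {A : lpm} (P Q : A -> Prop) :
  subalgebra P -> subalgebra Q -> subalgebra (fun x => P x /\ Q x).
Proof.
  intros [P1 P2 P3] [Q1 Q2 Q3]; split; firstorder.
Qed.

Lemma subalgebra_forall {A : lpm} {I : Type} (P : I -> A -> Prop) :
  (forall i, subalgebra (P i)) -> subalgebra (fun x => forall i, P i x).
Proof.
  intro H; split.
  - intro i; apply (H i).
  - intros x y Hx Hy i; now apply (H i).
  - intros x y Hx Hy i; now apply (H i).
Qed.

Lemma subalgebra_preim {A B : lpm} (f : lpm_hom A B) (P : B -> Prop) :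
  subalgebra P -> subalgebra (fun x => P (f x)).
Proof.
  intros [P1 P2 P3]; split; intros;
    rewrite ?lpm_fun_unit, ?lpm_fun_mul, ?lpm_fun_ldiv; auto.
Qed.

Lemma subalgebra_image {A B : lpm} (f : lpm_hom A B) :
  subalgebra (fun y => exists x, f x = y).
Proof.
  split.
  - exists unit_el; apply lpm_fun_unit.
  - intros _ _ [x <-] [y <-]; exists (mul x y); apply lpm_fun_mul.
  - intros _ _ [x <-] [y <-]; exists (ldiv x y); apply lpm_fun_ldiv.
Qed.

(* [E] is a subalgebra of [A * A], the product being indexed by [bool].  This
   stands in for a free algebra on one generator: it turns uniqueness of
   homomorphisms into injectivity on elements. *)
Lemma subalgebra_pairs_eq {A : lpm} (E : prod_lpm (fun _ : bool => A) -> Prop) :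
  subalgebra E ->
  (forall (T : lpm) (u v : lpm_hom T A),
     (forall t, E (fun b : bool => if b then u t else v t)) -> u = v) ->
  forall a b : A, E (fun c : bool => if c then a else b) -> a = b.
Proof.
  intros HE H a b Hab.
  set (u := lpm_comp _ _ _ (prod_proj (fun _ : bool => A) true) (sub_incl E HE)).
  set (v := lpm_comp _ _ _ (prod_proj (fun _ : bool => A) false) (sub_incl E HE)).
  assert (Euv : u = v).
  { apply H; intros [t Ht]; cbn.
    replace (fun b0 : bool => if b0 then t true else t false) with t; auto.
    apply functional_extensionality_dep; now intros []. }
  exact (hom_eq_app Euv (exist _ _ Hab)).
Qed.

(** * Categorical notions expressed on elements *)

Lemma mono_iff_injective {A B : lpm} (m : lpm_hom A B) :
  is_mono (C := LPM) m <-> forall a b, m a = m b -> a = b.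
Proof.
  split.
  - intros Hm a b Hab.
    (* The subalgebra of pairs is the kernel pair of [m]. *)
    refine (subalgebra_pairs_eq
      (fun x => lpm_comp _ _ _ m (prod_proj _ true) x
                = lpm_comp _ _ _ m (prod_proj _ false) x)
      (equalizer_subalgebra _ _) _ a b Hab).
    intros T u v Huv; apply Hm, lpm_hom_ext, Huv.
  - intros H T u v E; apply lpm_hom_ext; intro t; apply H.
    exact (hom_eq_app E t).
Qed.

Lemma product_jointly_injective {X Y P : lpm} (p : lpm_hom P X) (q : lpm_hom P Y) :
  is_product (C := LPM) p q ->
  forall a b, p a = p b -> q a = q b -> a = b.
Proof.
  intros Hpq a b Hp Hq.
  refine (subalgebra_pairs_eq
    (fun x => lpm_comp _ _ _ p (prod_proj _ true) x
              = lpm_comp _ _ _ p (prod_proj _ false) x /\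
              lpm_comp _ _ _ q (prod_proj _ true) x
              = lpm_comp _ _ _ q (prod_proj _ false) x)
    (subalgebra_and _ _ (equalizer_subalgebra _ _) (equalizer_subalgebra _ _))
    _ a b (conj Hp Hq)).
  intros T u v Huv.
  destruct (Hpq T (lpm_comp _ _ _ p v) (lpm_comp _ _ _ q v)) as [w [_ Hw]].
  transitivity w; [symmetry |]; apply Hw; split; auto;
    apply lpm_hom_ext; intro t; apply (Huv t).
Qed.

Lemma iso_of_bijective {A B : lpm} (m : lpm_hom A B) :
  (forall a b, m a = m b -> a = b) -> (forall y, exists x, m x = y) ->
  is_iso (C := LPM) m.
Proof.
  intros Hi Hs.
  destruct (functional_choice (fun y x => m x = y) Hs) as [n Hn].
  unshelve refine (ex_intro _ (@LpmHom B A n _ _ _) _).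
  - intros x y; apply Hi; now rewrite lpm_fun_mul, !Hn.
  - intros x y; apply Hi; now rewrite lpm_fun_ldiv, !Hn.
  - apply Hi; now rewrite lpm_fun_unit, Hn.
  - split; apply lpm_hom_ext; intro x; cbn; auto.
Qed.

Lemma iso_surjective {A B : lpm} (m : lpm_hom A B) :
  is_iso (C := LPM) m -> forall y, exists x, m x = y.
Proof.
  intros [n [_ H]] y; exists (lpm_fun n y); exact (hom_eq_app H y).
Qed.

(** A subalgebra includes by a mono, and a mono is injective with a subalgebra as image, so monos
    may be traded for predicates. *)
Lemma jointly_extremal_epi_iff {A B D : lpm} (f : lpm_hom A D) (g : lpm_hom B D) :
  jointly_extremal_epi (C := LPM) f g <->
  forall Q : D -> Prop, subalgebra Q ->
    (forall a, Q (f a)) -> (forall b, Q (g b)) -> forall d, Q d.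
Proof.
  split.
  - intros H Q HQ Hf Hg d.
    destruct (iso_surjective (sub_incl Q HQ)) with (y := d) as [[d' Hd'] <-]; auto.
    apply H.
    + apply mono_iff_injective, sig_ext.
    + exists (sub_corestr Q HQ f Hf); now apply lpm_hom_ext.
    + exists (sub_corestr Q HQ g Hg); now apply lpm_hom_ext.
  - intros H M m Hm [f' Hf] [g' Hg]; apply iso_of_bijective.
    + now apply mono_iff_injective.
    + apply H; [apply subalgebra_image | |].
      * intro a; exists (lpm_fun f' a); symmetry; exact (hom_eq_app Hf a).
      * intro b; exists (lpm_fun g' b); symmetry; exact (hom_eq_app Hg b).
Qed.

Lemma kernel_image {K A X : lpm} (k : lpm_hom K A) (f : lpm_hom A X) :
  is_kernel (C := LPM) k f ->
  forall a, f a = unit_el <-> exists x, k x = a.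
Proof.
  intros [Hk Huniv] a; split.
  - intro Ha.
    set (H := equalizer_subalgebra f (const_hom A X)).
    destruct (Huniv _ (sub_incl _ H)) as [u [Hu _]].
    + apply zero_morphism_iff; intros [x Hx]; exact Hx.
    + exists (lpm_fun u (exist _ a Ha)); exact (hom_eq_app Hu (exist _ a Ha)).
  - intros [x <-]; exact (proj1 (zero_morphism_iff _) Hk x).
Qed.

Lemma sub_incl_kernel {A X : lpm} (f : lpm_hom A X)
  (H : subalgebra (fun a => f a = unit_el)) :
  is_kernel (C := LPM) (sub_incl _ H) f.
Proof.
  split.
  - apply zero_morphism_iff; intros [x Hx]; exact Hx.
  - intros T t Ht.
    exists (sub_corestr _ H t (proj1 (zero_morphism_iff _) Ht)); split.
    + now apply lpm_hom_ext.
    + intros u Hu; apply lpm_hom_ext; intro x; apply sig_ext; symmetry.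
      exact (hom_eq_app Hu x).
Qed.

(** The fibre over the unit is the image of every kernel, and its inclusion is itself a kernel; this
    removes the quantifier over kernels. *)
Lemma strong_point_iff {A X : lpm} (f : lpm_hom A X) (s : lpm_hom X A) :
  strong_point (C := LPM) f s <->
  is_point (C := LPM) f s /\
  forall Q : A -> Prop, subalgebra Q ->
    (forall x, Q (s x)) -> (forall a, f a = unit_el -> Q a) -> forall a, Q a.
Proof.
  split; intros [Hp H]; split; auto.
  - intros Q HQ Hs Hf.
    set (HK := equalizer_subalgebra f (const_hom A X)).
    apply (proj1 (jointly_extremal_epi_iff s (sub_incl _ HK)));
      auto using sub_incl_kernel.
    intros [a Ha]; now apply Hf.
  - intros K k Hk; apply jointly_extremal_epi_iff.
    intros Q HQ Hs Hf; apply H; auto.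
    intros a Ha; apply (kernel_image k f Hk) in Ha; destruct Ha as [x <-]; auto.
Qed.

(** * Finite limits *)

(* The limit cannot be a product indexed by [J] itself, whose universe is too
   large for the carrier of an lpm; hence the [Set] of indices. *)
Lemma finite_small_cover (J : Type) :
  Finite J -> exists (I : Set) (d : I -> J), forall j, exists i, d i = j.
Proof.
  intros [[| j0 l] Hl].
  - exists Empty_set, (Empty_set_rect _); intro j; destruct (Hl j).
  (* Indices past the end give the default [j0], so [d] may repeat objects. Without any object there
     is no default, hence the separate empty case. *)
  - exists nat, (fun n => nth n (j0 :: l) j0); intro j.
    destruct (In_nth _ _ j0 (Hl j)) as [n [_ Hn]]; eauto.
Qed.

Section SmallLimit.

Variables (J : category) (F : functor J LPM) (I : Set) (d : I -> J)
  (index : J -> I) (d_index : forall j, d (index j) = j).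

(** The identity as an arrow between provably equal objects: its image under [F] moves elements
    without casting them. *)
Definition transport_hom {i j : J} (e : i = j) : hom i j :=
  eq_rect i (fun k => hom i k) (idm i) j e.

(** When [d n = d m], the arrows [a] include the identity, so repeated objects carry the same
    component. *)
Definition family_cone (x : prod_lpm (fun n => F (d n))) : Prop :=
  forall (n m : I) (a : hom (d n) (d m)), lpm_fun (fmap F a) (x n) = x m.

Lemma family_cone_subalgebra : subalgebra family_cone.
Proof.
  apply subalgebra_forall; intro n; apply subalgebra_forall; intro m.
  apply subalgebra_forall; intro a.
  exact (equalizer_subalgebra
    (lpm_comp _ _ _ (fmap F a) (prod_proj _ n)) (prod_proj _ m)).
Qed.

Definition family_limit : lpm := sub_lpm family_cone family_cone_subalgebra.

Definition family_limit_proj (j : J) : lpm_hom family_limit (F j) :=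
  lpm_comp _ _ _ (fmap F (transport_hom (d_index j)))
    (lpm_comp _ _ _ (prod_proj _ (index j)) (sub_incl _ _)).

(** The transport is an arrow from [d (index (d n))] to [d n], so the cone condition on [x] applies
    even if [index (d n)] is not [n]. *)
Lemma family_limit_proj_cover (n : I) (x : family_limit) :
  family_limit_proj (d n) x = proj1_sig x n.
Proof. exact (proj2_sig x _ _ _). Qed.

Lemma family_limit_is_limit : is_limit F family_limit family_limit_proj.
Proof.
  split.
  (* Stated for objects [d n] first; rewriting [d (index i)] to [i] then gives all objects. *)
  - assert (H : forall n m (a : hom (d n) (d m)),
      lpm_comp _ _ _ (fmap F a) (family_limit_proj (d n))
      = family_limit_proj (d m)).
    { intros n m a; apply lpm_hom_ext; intro x; cbn [lpm_comp lpm_fun].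
      rewrite !family_limit_proj_cover; apply (proj2_sig x). }
    intros i j; generalize (H (index i) (index j)).
    rewrite !d_index; auto.
  - intros T q Hq.
    assert (Hc : forall t, family_cone
      (prod_tuple (fun n => F (d n)) T (fun n => q (d n)) t)).
    { intros t n m a; exact (hom_eq_app (Hq _ _ a) t). }
    exists (sub_corestr _ family_cone_subalgebra _ Hc); split.
    + intro j; apply lpm_hom_ext; intro t; exact (hom_eq_app (Hq _ _ _) t).
    + intros u Hu; apply lpm_hom_ext; intro t; apply sig_ext.
      apply functional_extensionality_dep; intro n.
      rewrite <- (family_limit_proj_cover n (lpm_fun u t)); symmetry.
      exact (hom_eq_app (Hu (d n)) t).
Qed.

End SmallLimit.

Lemma LPM_finitely_complete : finitely_complete LPM.
Proof.
  intros J F [HJ _].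
  destruct (finite_small_cover J HJ) as (I & d & Hd).
  destruct (functional_choice (fun j i => d i = j) Hd) as [index Hindex].
  exists (family_limit J F I d), (family_limit_proj J F I d index Hindex).
  apply family_limit_is_limit.
Qed.

Lemma LPM_unital : unital LPM.
Proof.
  split; [exists one_lpm; apply one_lpm_zero |].
  split; [exact LPM_finitely_complete |].
  intros X Y P p q Hpq l r pl ql pr qr.
  apply jointly_extremal_epi_iff; intros Q HQ Hl Hr a.
  (* In coordinates, [(x, y) = (x, e) * (e, y)]. *)
  replace a with (mul (lpm_fun l (lpm_fun p a)) (lpm_fun r (lpm_fun q a)));
    [now apply HQ |].
  apply (product_jointly_injective p q Hpq); rewrite lpm_fun_mul.
  - rewrite (proj1 (zero_morphism_iff _) pr (lpm_fun q a) :
      lpm_fun p (lpm_fun r _) = _), <- mul_1r.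
    exact (hom_eq_app pl _).
  - rewrite (proj1 (zero_morphism_iff _) ql (lpm_fun p a) :
      lpm_fun q (lpm_fun l _) = _), <- mul_1l.
    exact (hom_eq_app qr _).
Qed.

(** * Pulling a point back along a subalgebra of its base *)

Section RestrictedPoint.

Variables (A X : lpm) (f : lpm_hom A X) (s : lpm_hom X A)
  (fs : is_point (C := LPM) f s) (P : X -> Prop) (HP : subalgebra P).

Definition restr_total : lpm :=
  sub_lpm (fun a => P (f a)) (subalgebra_preim f P HP).

Definition restr_map : lpm_hom restr_total (sub_lpm P HP) :=
  sub_corestr P HP (lpm_comp _ _ _ f (sub_incl _ _)) (fun a => proj2_sig a).

Definition restr_section : lpm_hom (sub_lpm P HP) restr_total.
Proof.
  refine (sub_corestr _ _ (lpm_comp _ _ _ s (sub_incl _ _)) _).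
  intros [x Hx]; cbn.
  rewrite (hom_eq_app fs x : f (s x) = x); exact Hx.
Defined.

Lemma restr_is_point : is_point (C := LPM) restr_map restr_section.
Proof.
  apply lpm_hom_ext; intro x; apply sig_ext; exact (hom_eq_app fs _).
Qed.

Lemma restr_is_pullback :
  is_pullback (C := LPM) (sub_incl P HP) f restr_map (sub_incl _ _).
Proof.
  split; [now apply lpm_hom_ext |].
  intros T a b Hab.
  assert (Hb : forall t, P (f (lpm_fun b t))).
  { intro t.
    rewrite <- (hom_eq_app Hab t : proj1_sig (lpm_fun a t) = f (lpm_fun b t)).
    exact (proj2_sig (lpm_fun a t)). }
  exists (sub_corestr (fun a => P (f a)) (subalgebra_preim f P HP) b Hb).
  split; [split |].
  - apply lpm_hom_ext; intro t; apply sig_ext; symmetry.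
    exact (hom_eq_app Hab t).
  - now apply lpm_hom_ext.
  - intros u [_ Hu]; apply lpm_hom_ext; intro t; apply sig_ext; symmetry.
    exact (hom_eq_app Hu t).
Qed.

Lemma restr_strong_of_stably_strong :
  stably_strong_point (C := LPM) f s ->
  strong_point (C := LPM) restr_map restr_section.
Proof.
  intros [_ H]; apply (H _ _ _ _ _ restr_is_pullback).
  - exact restr_is_point.
  - now apply lpm_hom_ext.
Qed.

End RestrictedPoint.

(** * The object [base] and a point over it *)

Open Scope Z_scope.

(** For [x >= 2] the unit law sends [0] to [x], so the value [0] is taken at [2] and larger
    arguments shift down by one. The value [x] is then also taken at [x + 1], which [base_ldiv]
    selects as [x \ x]. *)
Definition base_mul (x y : Z) : Z :=
  if x <=? 1 then x + y
  else if y =? 0 then x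
  else if y =? 2 then 0
  else if 2 <? y then y - 1
  else y.

Definition base_ldiv (x y : Z) : Z :=
  if x <=? 1 then y - x
  else if y =? 0 then 2
  else if 2 <=? y then y + 1
  else y.

Ltac case_Z_test t :=
  match t with
  | context [?x <=? ?y] => destruct (Z.leb_spec x y)
  | context [?x <? ?y] => destruct (Z.ltb_spec x y)
  | context [?x =? ?y] => destruct (Z.eqb_spec x y)
  end.

Ltac case_Z_tests :=
  repeat match goal with
  | |- ?t => case_Z_test t
  | _ : ?t |- _ => case_Z_test t
  end; try lia.

Definition base : lpm.
Proof.
  refine (Lpm Z base_mul base_ldiv 0 _ _ _);
    intros; unfold base_mul, base_ldiv; case_Z_tests.
Defined.

Lemma base_weakly_protomodular : weakly_protomodular (C := LPM) base.
Proof.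
  intros A f s fs; apply strong_point_iff; split; [exact fs |].
  intros Q HQ Hs Hf.
  assert (Hfs : forall x, lpm_fun f (lpm_fun s x) = x)
    by exact (hom_eq_app fs).
  assert (step : forall (x : base) a, Q (ldiv (lpm_fun s x) a) -> Q a).
  { intros x a Ha; rewrite (mul_ldiv _ (lpm_fun s x) a); now apply HQ. }
  (* The bound starts at [1], so the base case covers all negative values too. *)
  assert (H : forall (n : nat) a, (lpm_fun f a : Z) <= 1 + Z.of_nat n -> Q a).
  { induction n as [| n IH]; intros a Ha.
    - apply (step (lpm_fun f a)), Hf; rewrite lpm_fun_ldiv, Hfs.
      cbn; unfold base_ldiv; revert Ha; generalize (lpm_fun f a : Z).
      intros; case_Z_tests.
    - apply (step 1), IH; rewrite lpm_fun_ldiv, Hfs.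
      change (base_ldiv 1 (lpm_fun f a) <= 1 + Z.of_nat n).
      unfold base_ldiv; revert Ha.
      generalize (lpm_fun f a : Z); intros; case_Z_tests. }
  intro a; apply (H (Z.to_nat (lpm_fun f a : Z))).
  generalize (lpm_fun f a : Z); lia.
Qed.

(** For [x <= 1] the kernel translates the fibre over [x]: [(x, i) * (0, j) = (x, i + j)]. For
    [x >= 2] it fixes that fibre, and [j / 2] undoes the doubling in [(x, i) \ (0, j) = (2, j * 2)];
    rounding at odd [j] breaks no law. *)
Definition total_mul (a b : Z * Z) : Z * Z :=
  let (x, i) := a in let (y, j) := b in
  (base_mul x y,
   if y =? 0 then (if x <=? 1 then i + j else i)
   else if x <=? 1 then j
   else if y =? 2 then j / 2
   else j).

Definition total_ldiv (a b : Z * Z) : Z * Z :=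
  let (x, i) := a in let (y, j) := b in
  (base_ldiv x y,
   if x <=? 1 then (if y =? x then j - i else j)
   else if y =? 0 then j * 2
   else j).

Definition total : lpm.
Proof.
  refine (Lpm (Z * Z) total_mul total_ldiv (0, 0) _ _ _).
  - intros [x i] [y j]; unfold total_mul, total_ldiv, base_mul, base_ldiv.
    case_Z_tests; f_equal; rewrite ?Z.div_mul; lia.
  - intros [y j]; unfold total_mul, base_mul; case_Z_tests; f_equal; lia.
  - intros [x i]; unfold total_mul, base_mul; case_Z_tests; f_equal; lia.
Defined.

Definition total_map : lpm_hom total base.
Proof.
  refine (@LpmHom total base fst _ _ _); [| | reflexivity];
    intros [x i] [y j]; reflexivity.
Defined.

Definition total_section : lpm_hom base total.
Proof.
  refine (@LpmHom base total (fun x => (x, 0)) _ _ _); [| | reflexivity];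
    intros x y; cbn; f_equal; case_Z_tests; reflexivity.
Defined.

Lemma total_is_point : is_point (C := LPM) total_map total_section.
Proof. now apply lpm_hom_ext. Qed.

(** * The subobject and the failure of strength *)

Definition gap (x : base) : Prop := (x : Z) = 0 \/ 2 <= (x : Z).

(** Row [0] is the identity. For [x >= 2], products are [x], [0] or [y - 1] with [y > 2], and
    quotients are [2] or [y + 1]. *)
Lemma gap_subalgebra : subalgebra gap.
Proof.
  split; unfold gap; cbn; unfold base_mul, base_ldiv; intros;
    case_Z_tests.
Qed.

(* The elements [(0, i)] and [(x, 2 * i)] form a proper subalgebra of the
   restricted total object: the map [i |-> i * 2] in [total_ldiv] embeds the
   kernel into the even part of the fibre over [2]. *)
Lemma restr_total_not_strong :
  ~ strong_point (C := LPM) (restr_map _ _ total_map gap gap_subalgebra)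
      (restr_section _ _ total_map total_section total_is_point
         gap gap_subalgebra).
Proof.
  intro H; apply strong_point_iff in H; destruct H as [_ H].
  set (E := restr_total _ _ total_map gap gap_subalgebra) in H.
  assert (H21 : gap 2) by (right; cbn; lia).
  specialize (H (fun a : E => fst (proj1_sig a) = 0 \/ Z.Even (snd (proj1_sig a)))).
  (* An odd element over [2] lies outside the subalgebra. *)
  assert (HQ : fst (2, 1) = 0 \/ Z.Even (snd (2, 1))).
  { refine (H _ _ _ (exist _ ((2, 1) : total) H21)).
    - split.
      + now left.
      + intros [[x i] Hx] [[y j] Hy]; cbn in *; unfold gap, base_mul in *; cbn in *.
        intros Qx Qy; case_Z_tests; (left; lia) || (right; destruct Qx, Qy; auto; lia).
      + intros [[x i] Hx] [[y j] Hy]; cbn in *; unfold gap, base_ldiv in *; cbn in *.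
        (* The witness [j] serves the quotient [(2, j * 2)]; otherwise parity is inherited. *)
        intros Qx Qy; case_Z_tests; try (left; lia);
          try (right; exists j; lia); right; destruct Qx, Qy; auto; lia.
    - intros [x Hx]; right; exists 0; reflexivity.
    - intros [[x i] Hx] Ha; left.
      exact (f_equal (fun z => proj1_sig z) Ha). }
  cbn in HQ; destruct HQ as [HQ | [k Hk]]; lia.
Qed.

Lemma gap_not_weakly_protomodular :
  ~ weakly_protomodular (C := LPM) (sub_lpm gap gap_subalgebra).
Proof.
  intro H; apply restr_total_not_strong, H, restr_is_point.
Qed.

Lemma base_not_protomodular : ~ protomodular (C := LPM) base.
Proof.
  intro H; apply restr_total_not_strong, restr_strong_of_stably_strong.
  apply H, total_is_point.
Qed.

Close Scope Z_scope.

Theorem mainTheorem1 :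
  unital LPM /\
  (exists X : LPM,
     weakly_protomodular X /\
     (exists (S : LPM) (m : hom S X), is_mono m /\ ~ weakly_protomodular S) /\
     ~ protomodular X) /\
  ~ (forall C : category, unital C ->
       forall X : C, protomodular X <-> weakly_protomodular X).
Proof.
  split; [exact LPM_unital | split].
  - exists base; split; [exact base_weakly_protomodular | split].
    + exists (sub_lpm gap gap_subalgebra), (sub_incl gap gap_subalgebra).
      split; [apply mono_iff_injective, sig_ext |].
      exact gap_not_weakly_protomodular.
    + exact base_not_protomodular.
  - intro H; apply base_not_protomodular, (H LPM LPM_unital base).
    exact base_weakly_protomodular.
Qed.
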